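(* Let $T_1,\dots,T_n$ be doubly commuting contractions acting on a Hilbert space $\mathcal H$. Then there corresponds a decomposition of $\mathcal H$ into an orthogonal sum of $2^n$ subspaces $\mathcal H_1,\dots,\mathcal H_{2^n}$ of $\mathcal H$ such that: (1) each $\mathcal H_j$, $1\le j\le 2^n$, is a joint reducing subspace for $T_1,\dots,T_n$; (2) $T_i|_{\mathcal H_j}$ is either a unitary or a c.n.u. contraction for all $i=1,\dots,n$ and $j=1,\dots,2^n$; (3) if $\mathcal F_n=\{(\mathcal A_j,\mathcal H_j):1\le j\le 2^n\}$, where $\mathcal A_j=(T_1|_{\mathcal H_j},\dots,T_n|_{\mathcal H_j})$ for each $j$, and if $\mathcal M_n$ is the set of all functions $f:\{1,\dots,n\}\to\{A1,A2\}$, then corresponding to every $g\in\mathcal M_n$ there exists a unique element $(\mathcal A_g,\mathcal H_g)\in\mathcal F_n$ such that the $k$-th component of $\mathcal A_g$ is of type $g(k)$, for $1\le k\le n$; (4) $\mathcal H_1$ is the maximal joint reducing subspace for $T_1,\dots,T_n$ such that $T_1|_{\mathcal H_1},\dots,T_n|_{\mathcal H_1}$ are unitaries; (5) $\mathcal H_{2^n}$ is the maximal joint reducing subspace for $T_1,\dots,T_n$ such that $T_1|_{\mathcal H_{2^n}},\dots,T_n|_{\mathcal H_{2^n}}$ are c.n.u. contractions. One or more members of $\{\mathcal H_j:j=1,\dots,2^n\}$ may coincide with the trivial subspace $\{0\}$.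
   Context: Operators are bounded linear operators on complex Hilbert spaces; a contraction is an operator of norm at most $1$. Commuting contractions $T_1,\dots,T_n$ are doubly commuting if $T_iT_j^*=T_j^*T_i$ for all $i\neq j$. A contraction $T$ is completely non-unitary (c.n.u.) if no nonzero closed subspace reduces $T$ to a unitary. A contraction is an atom of type $A1$ if it is a unitary, and an atom of type $A2$ if it is a c.n.u. contraction. Elements of $\mathcal F_n$ are counted with their index $j$ (so there are $2^n$ of them), each carrying an assigned list of types for its components, also when $\mathcal H_j=\{0\}$. *)

(* Defs.v *)
From HB Require Import structures.
From mathcomp Require Import all_boot all_order all_algebra.
From mathcomp Require Import all_classical all_reals all_analysis.
From mathcomp Require Import complex.

Set Implicit Arguments.
Unset Strict Implicit.
Unset Printing Implicit Defensive.

Import Order.TTheory GRing.Theory Num.Theory.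
Import numFieldNormedType.Exports.

Local Open Scope classical_set_scope.
Local Open Scope ring_scope.
Local Open Scope complex_scope.

(* A complex Hilbert space: the scalars are R[i], and inner is linear in its
   first argument and conjugate-linear in its second. It is positive definite
   because it induces the norm. *)
HB.mixin Record isHilbert (R : realType) V of CompleteNormedModule R[i] V := {
  inner : V -> V -> R[i] ;
  inner_linearl : forall (a : R[i]) (x y z : V),
    inner (a *: x + y) z = a * inner x z + inner y z ;
  inner_conj : forall x y : V, inner y x = Num.conj (inner x y) ;
  normr_inner : forall x : V, `|x| ^+ 2 = inner x x }.

#[short(type="hilbertType")]
HB.structure Definition Hilbert (R : realType) :=
  { V of isHilbert R V & CompleteNormedModule R[i] V }.

Section InnerDot.
Variables (R : realType) (V : hilbertType R).

Lemma inner_bilinear :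
  bilinear_for ( *%R : R[i] -> R[i] -> R[i])
    (Num.conj \; *%R : R[i] -> R[i] -> R[i]) (@inner R V).
Proof.
split=> [z a x y|x a y z] /=; first exact: inner_linearl.
by rewrite inner_conj (inner_conj y) (inner_conj z) inner_linearl
           rmorphD rmorphM.
Qed.

HB.instance Definition _ :=
  bilinear_isBilinear.Build R[i] V V R[i] _ _ (@inner R V) inner_bilinear.

Lemma inner_hermitian (x y : V) :
  inner x y = (-1) ^+ false * Num.conj (inner y x).
Proof. by rewrite expr0 mul1r -inner_conj. Qed.

HB.instance Definition _ :=
  isHermitianSesquilinear.Build R[i] V false Num.conj (@inner R V)
    inner_hermitian.

Lemma inner_gt0 (x : V) : x != 0 -> 0 < inner x x.
Proof. by move=> x0; rewrite -normr_inner exprn_gt0 ?normr_gt0. Qed.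

HB.instance Definition _ :=
  isDotProduct.Build R[i] V (@inner R V) inner_gt0.

End InnerDot.

Section Operators.
Variables (R : realType) (V : hilbertType R).
Implicit Types (T : {linear V -> V}) (M N : set V) (x y z : V).

Definition closed_subspace M : Prop :=
  [/\ closed M, M 0 & forall (a : R[i]) x y, M x -> M y -> M (a *: x + y)].

(* The predicates ..._on M T describe the operator T|_M : M -> M on the Hilbert
   space M, where M is a closed subspace invariant under T; M = setT gives the
   notions for T itself. *)

Definition invariant M T : Prop := forall x, M x -> M (T x).

(* Values of the norm lie in R[i], so their real parts are taken. The supremum
   is +oo if T|_M is unbounded. *)
Definition opnorm_on M T : \bar R :=
  ereal_sup [set (complex.Re `|T x|)%:E | x in [set x | M x /\ `|x| <= 1]].

Definition contraction_on M T : Prop := invariant M T /\ (opnorm_on M T <= 1)%E.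

(* The adjoint (T|_M)^* : M -> M. For T|_M bounded and y in M, the element z
   exists by the Riesz representation theorem, and it is unique. *)
Definition adjoint_on M T : V -> V := fun y =>
  xget 0 [set z | M z /\ forall x, M x -> inner (T x) y = inner x z].

Definition unitary_on M T : Prop :=
  invariant M T /\
  forall x, M x -> adjoint_on M T (T x) = x /\ T (adjoint_on M T x) = x.

(* N is a reducing subspace of T|_M. *)
Definition reduces_on M T N : Prop :=
  [/\ closed_subspace N, N `<=` M, invariant N T &
      forall x, N x -> N (adjoint_on M T x)].

Definition cnu_on M T : Prop :=
  contraction_on M T /\
  ~ exists N, [/\ N <> [set 0], reduces_on M T N & unitary_on N T].

Definition contraction_op T : Prop := contraction_on setT T.
Definition adjoint T : V -> V := adjoint_on setT T.
Definition reduces T N : Prop := reduces_on setT T N.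

Definition joint_reducing (n : nat) (T : 'I_n -> {linear V -> V}) N : Prop :=
  closed_subspace N /\ forall i, reduces (T i) N.

Definition doubly_commuting (n : nat) (T : 'I_n -> {linear V -> V}) : Prop :=
  (forall i j x, T i (T j x) = T j (T i x)) /\
  (forall i j, i != j ->
     forall x, T i (adjoint (T j) x) = adjoint (T j) (T i x)).

Definition orthogonal_decomposition (m : nat) (H : 'I_m -> set V) : Prop :=
  [/\ forall j, closed_subspace (H j),
      forall j k, j != k -> forall x y, H j x -> H k y -> inner x y = 0 &
      forall x, exists y : 'I_m -> V, (forall j, H j (y j)) /\ x = \sum_j y j].

End Operators.

Variant atom_type := A1 | A2.

Definition atom_on (R : realType) (V : hilbertType R) (M : set V)
    (T : {linear V -> V}) (a : atom_type) : Prop :=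
  match a with
  | A1 => unitary_on M T
  | A2 => cnu_on M T
  end.

Lemma pow2_gt0 n : (0 < 2 ^ n)%N.
Proof. by rewrite expn_gt0. Qed.

Lemma pow2_pred_lt n : ((2 ^ n).-1 < 2 ^ n)%N.
Proof. by rewrite prednK ?pow2_gt0. Qed.

(* The indices 1, ..., 2^n are represented by 0, ..., 2^n - 1. *)
Definition first_index n : 'I_(2 ^ n) := Ordinal (pow2_gt0 n).
Definition last_index n : 'I_(2 ^ n) := Ordinal (pow2_pred_lt n).

(* Main.v *)
Require Import Defs.
From HB Require Import structures.
From mathcomp Require Import all_boot all_order all_algebra.
From mathcomp Require Import all_classical all_reals all_analysis.
From mathcomp Require Import complex.
From mathcomp Require Import ring.

Set Implicit Arguments.
Unset Strict Implicit.
Unset Printing Implicit Defensive.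

Import Order.TTheory GRing.Theory Num.Theory.
Import numFieldNormedType.Exports.

Local Open Scope classical_set_scope.
Local Open Scope ring_scope.

(* The unitary part U(T) of a contraction T consists of the vectors x such that
   T^*T and TT^* fix w x for every word w in T and T^*. It is visibly the
   largest reducing subspace on which T is unitary, so T is c.n.u. on its
   orthogonal complement, and every operator commuting with T and T^* maps U(T)
   into itself. Double commutativity therefore makes each U(T_i) reduce every
   T_j, which forces the projections onto the U(T_i) to preserve each U(T_j)
   and its complement. The 2^n summands are the intersections over i of U(T_i)
   or its complement.
   If N reduces T, the components of a vector of U(T) along N and its
   complement lie in U(T) again; hence a reducing subspace on which T is c.n.u.
   is orthogonal to U(T), which gives the maximality in (5). *)

(** * Inner product geometry and projections onto closed subspaces *)

Section Geometry.
Variables (R : realType) (V : hilbertType R).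
Implicit Types (x y z : V) (M : set V).

Lemma innerDr x y z : inner x (y + z) = inner x y + inner x z.
Proof. exact: linearDr. Qed.

Lemma innerDl x y z : inner (x + y) z = inner x z + inner y z.
Proof. exact: linearDl. Qed.

Lemma innerBl x y z : inner (x - y) z = inner x z - inner y z.
Proof. exact: linearBl. Qed.

Lemma innerBr x y z : inner x (y - z) = inner x y - inner x z.
Proof. exact: linearBr. Qed.

Lemma innerZl a x y : inner (a *: x) y = a * inner x y.
Proof. exact: linearZl_LR. Qed.

Lemma innerZr a x y : inner x (a *: y) = Num.conj a * inner x y.
Proof. exact: linearZr_LR. Qed.

Lemma inner0r x : inner x 0 = 0.
Proof. exact: linear0r. Qed.

Lemma inner_eq0 x : inner x x = 0 -> x = 0.
Proof. by rewrite -normr_inner => /eqP; rewrite expf_eq0 normr_eq0 => /eqP. Qed.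

Lemma inner_sym0 x y : inner x y = 0 -> inner y x = 0.
Proof. by move=> h; rewrite inner_conj h rmorph0. Qed.

Lemma inner_injr y z : (forall x, inner x y = inner x z) -> y = z.
Proof.
move=> h; apply/eqP; rewrite -subr_eq0; apply/eqP/inner_eq0.
by rewrite innerBr h subrr.
Qed.

Lemma normD_sqr x y :
  `|x + y| ^+ 2 = `|x| ^+ 2 + `|y| ^+ 2 + (inner x y + Num.conj (inner x y)).
Proof. by rewrite !normr_inner; exact: dnormD. Qed.

Lemma normB_sqr x y :
  `|x - y| ^+ 2 = `|x| ^+ 2 + `|y| ^+ 2 - (inner x y + Num.conj (inner x y)).
Proof. by rewrite !normr_inner; exact: dnormB. Qed.

(** Pythagoras for the component of [x] along [y]. Nonnegativity of the left side yields
    Cauchy-Schwarz, and the formula measures how much a correction along [y] shortens [x]. *)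
Lemma norm_sub_proj x y : y != 0 ->
  `|x - (inner x y / inner y y) *: y| ^+ 2 =
  `|x| ^+ 2 - `|inner x y| ^+ 2 / `|y| ^+ 2.
Proof.
move=> y0; have yy : inner y y != 0 by rewrite gt_eqF ?inner_gt0.
have ryy : Num.conj (inner y y) = inner y y by rewrite -inner_conj.
have hc : Num.conj (inner x y / inner y y) = inner y x / inner y y.
  by rewrite rmorphM fmorphV (inner_conj x y); congr (_ / _).
rewrite !normr_inner innerBl !innerBr !innerZl !innerZr hc divfK // subrr subr0.
by rewrite mulrAC (inner_conj x y) normCKC.
Qed.

Lemma cauchy_schwarz x y : `|inner x y| <= `|x| * `|y|.
Proof.
have [->|y0] := eqVneq y 0; first by rewrite inner0r !normr0 mulr0.
have y2 : 0 < `|y| ^+ 2 by rewrite exprn_gt0 ?normr_gt0.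
rewrite -ler_sqr ?nnegrE ?mulr_ge0 // exprMn -ler_pdivrMr // -subr_ge0.
by rewrite -norm_sub_proj // exprn_ge0.
Qed.

Lemma parallelogram x y :
  `|x + y| ^+ 2 + `|x - y| ^+ 2 = 2 * (`|x| ^+ 2 + `|y| ^+ 2).
Proof.
by rewrite normD_sqr normB_sqr addrACA subrr addr0 -mulr2n mulr_natl.
Qed.

(** The order of [R[i]] compares only elements with equal imaginary parts, so nonnegative elements
    are real and the infimum is that of the real parts. *)
Lemma complex_glb (E : set R[i]) : E !=set0 -> (forall a, E a -> 0 <= a) ->
  exists d, (forall a, E a -> d <= a) /\
            (forall e, 0 < e -> exists2 a, E a & a < d + e).
Proof.
move=> [a0 Ea0] E0; pose D := [set complex.Re a | a in E].
have ReE a : E a -> a = (complex.Re a)%:C%C.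
  by move=> /E0; case: a => ar ai; rewrite lecE /= => /andP[/eqP-> _].
have hD : has_inf D.
  split; first by exists (complex.Re a0); exists a0.
  by exists 0 => _ [a Ea <-]; move: (E0 _ Ea); rewrite lecE => /andP[].
exists (inf D)%:C%C; split=> [a Ea|e e0].
  by rewrite (ReE _ Ea) lecR; apply: ge_inf; [case: hD|exists a].
have ee : e = (complex.Re e)%:C%C.
  by move: e0; case: (e) => er ei; rewrite ltcE /= => /andP[/eqP-> _].
have e0' : 0 < complex.Re e by move: e0; rewrite ltcE => /andP[].
have [_ [a Ea <-] h] := inf_adherent e0' hD.
by exists a => //; rewrite ee (ReE _ Ea) -rmorphD /= ltcR.
Qed.

Lemma closed_subspaceD M x y : closed_subspace M -> M x -> M y -> M (x + y).
Proof. by move=> [_ _ h] Mx My; rewrite -[x]scale1r; exact: h. Qed.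

Lemma closed_subspaceZ M a x : closed_subspace M -> M x -> M (a *: x).
Proof. by move=> [_ h0 h] Mx; rewrite -[_ *: _]addr0; exact: h. Qed.

Lemma closed_subspaceB M x y : closed_subspace M -> M x -> M y -> M (x - y).
Proof.
move=> cM Mx My; rewrite -scaleN1r; apply: closed_subspaceD => //.
exact: closed_subspaceZ.
Qed.

Definition orthocomp M : set V := [set y | forall x, M x -> inner x y = 0].

Lemma orthogonal_projection M x : closed_subspace M ->
  exists2 p, M p & orthocomp M (x - p).
Proof.
move=> cM; have [clM M0 _] := cM.
have [||d [dle dlt]] := @complex_glb [set `|x - m| ^+ 2 | m in M].
- by exists (`|x - 0| ^+ 2); exists 0.
- by move=> _ [m _ <-]; rewrite exprn_ge0.
(* The near-minimizers of the distance from x to M form a Cauchy filter, by the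
   parallelogram identity. *)
pose A (e : R[i]) := [set m | M m /\ `|x - m| ^+ 2 < d + e].
pose F := filter_from [set e : R[i] | 0 < e] A.
have FF : ProperFilter F.
  apply: filter_from_proper; last first.
    by move=> e /= /dlt[_ [m Mm <-] h]; exists m.
  apply: filter_from_filter; first by exists 1 => /=.
  move=> e f /= e0 f0.
  have ef := real_leVge (gtr0_real e0) (gtr0_real f0).
  case/orP: ef => h; [exists e => // | exists f => //] => m [Mm lm];
    by split; split=> //; apply: (lt_le_trans lm); rewrite lerD2l.
have cF : cauchy F.
  (* The midpoint of [z] and [w] lies in [M], so its squared distance to [x] is at least [d]. The
     parallelogram identity then bounds the squared distance from [z] to [w] by [4 * e'], which is
     to be [e ^+ 2]. *)
  apply: cauchy_exP => e e0; pose e' := e ^+ 2 / 4.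
  have e'0 : 0 < e' by rewrite divr_gt0 ?exprn_gt0.
  have [_ [z Mz <-] hz] := dlt _ e'0.
  exists z; exists e' => // w [Mw hw]; rewrite -ball_normE /=.
  rewrite -ltr_sqr ?nnegrE ?(ltW e0) //.
  have -> : z - w = (x - w) - (x - z) by rewrite opprB [RHS]addrC addrA subrK.
  rewrite -(ltrD2l (`|(x - w) + (x - z)| ^+ 2)) parallelogram.
  have -> : (x - w) + (x - z) = 2 *: (x - 2^-1 *: (w + z)).
    rewrite scalerBr scalerA mulfV ?pnatr_eq0 // scale1r opprD addrACA.
    by rewrite scaler_nat mulr2n.
  rewrite normrZ exprMn normr_nat -natrX.
  have := dle (`|x - 2^-1 *: (w + z)| ^+ 2).
  have Mm : M (2^-1 *: (w + z)).
    by apply: closed_subspaceZ => //; exact: closed_subspaceD.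
  move=> /(_ (ex_intro2 _ _ _ Mm erefl)) dm.
  apply: (@lt_le_trans _ _ (2 * (d + e' + (d + e')))).
    by rewrite ltr_pM2l // ltrD.
  have -> : 2 * (d + e' + (d + e')) = 4 * d + e ^+ 2.
    by rewrite /e'; field.
  by rewrite lerD2r ler_pM2l.
have cvF := @cauchy_cvg _ F FF cF; set p := lim F in cvF.
exists p.
  have FM : F M by exists 1; [exact: ltr01|move=> w []].
  exact: (@closed_cvg _ _ F FF id M clM FM p cvF).
(* Suppose that [c], the modulus of [inner (x - p) m], is positive. A near-minimizer [w] close to
   [p] splits this inner product into two terms, each of modulus below [c / 2]. *)
move=> m Mm; apply: inner_sym0.
have [->|m0] := eqVneq m 0; first by rewrite inner0r.
have nm0 : 0 < `|m| by rewrite normr_gt0.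
apply/eqP; rewrite -normr_eq0 eq_le normr_ge0 andbT.
apply/contraT => c0; have {c0} : 0 < `|inner (x - p) m|.
  by rewrite lt_neqAle normr_ge0 andbT eq_sym; apply: contra c0 => /eqP->.
set c : R[i] := `|_| => c0.
have [e e0 ec] : exists2 e : R[i], 0 < e & e * `|m| = c / 2.
  by exists (c / 2 / `|m|); rewrite ?divfK ?gt_eqF // !divr_gt0.
have [w [[Mw dw] wp]] : exists w, A (e ^+ 2) w /\ `|p - w| < e.
  apply: (@filter_ex _ F); apply: filterI.
    by exists (e ^+ 2) => //=; rewrite exprn_gt0.
  have := cvF _ (nbhsx_ballx p e e0).
  by rewrite -ball_normE.
(* Correcting [w] along [m] stays in [M], so it cannot bring the squared distance to [x] below [d].
   Since that of [w] is below [d + e ^+ 2], the component of [x - w] along [m] has norm below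
   [e]. *)
have h1 : `|inner (x - w) m| < e * `|m|.
  rewrite -ltr_sqr ?nnegrE ?(mulr_ge0 (ltW e0)) // exprMn.
  rewrite -ltr_pdivrMr ?exprn_gt0 //.
  rewrite -(ltrD2l d); apply: le_lt_trans dw.
  rewrite -lerBrDr -norm_sub_proj //; apply: dle.
  exists (w + (inner (x - w) m / inner m m) *: m); last by rewrite opprD addrA.
  by apply: closed_subspaceD => //; exact: closed_subspaceZ.
have h2 : `|inner (w - p) m| < e * `|m|.
  apply: le_lt_trans (cauchy_schwarz _ _) _.
  by rewrite ltr_pM2r // distrC.
have : c < c.
  rewrite {1}/c -[x](subrK w) -addrA innerDl.
  apply: le_lt_trans (ler_normD _ _) _.
  apply: lt_le_trans (ltrD h1 h2) _.
  by rewrite ec -splitr.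
by rewrite ltxx.
Qed.
End Geometry.

(** * Closed subspaces, orthogonal complements and Riesz representation *)

Section Subspaces.
Variables (R : realType) (V : hilbertType R).
Implicit Types (x y z : V) (M N : set V).

(** If [f x] is nonzero, the ball about [x] whose radius is the norm of [f x] over [C + 1] contains
    no zero of [f]; adding 1 covers [C = 0]. *)
Lemma closed_zeros (W : normedZmodType R[i]) (f : V -> W) (C : R[i]) :
  0 <= C -> (forall x y, `|f x - f y| <= C * `|x - y|) ->
  closed [set x | f x = 0].
Proof.
move=> C0 lipf x clx /=; apply: contrapT => /eqP fx0.
have e0 : 0 < `|f x| / (C + 1) by rewrite divr_gt0 ?normr_gt0 // ltr_wpDl.
have [y [/= fy0]] := clx _ (nbhsx_ballx x _ e0).
rewrite -ball_normE /= ltr_pdivlMr ?ltr_wpDl // => xy.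
have := lipf x y; rewrite fy0 subr0 => h.
have : `|f x| < `|f x|.
  apply: le_lt_trans h (le_lt_trans _ xy).
  by rewrite mulrC ler_wpM2l // lerDl ler01.
by rewrite ltxx.
Qed.

Lemma closed_subspaceI M N :
  closed_subspace M -> closed_subspace N -> closed_subspace (M `&` N).
Proof.
move=> [cM M0 hM] [cN N0 hN]; split; first exact: closedI.
  by [].
by move=> a x y [? ?] [? ?]; split; [apply: hM|apply: hN].
Qed.

Lemma closed_subspace_bigcap (I : Type) (M : I -> set V) :
  (forall i, closed_subspace (M i)) -> closed_subspace (\bigcap_i M i).
Proof.
move=> hM; split; first by apply: closed_bigI => i _; case: (hM i).
  by move=> i _; case: (hM i).
move=> a x y Mx My i _; case: (hM i) => _ _; apply; [exact: Mx|exact: My].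
Qed.

Lemma orthocomp_closed_subspace M : closed_subspace (orthocomp M).
Proof.
split; last 2 first.
- by move=> x _; rewrite inner0r.
- by move=> a x y hx hy z Mz; rewrite innerDr innerZr hx // hy // mulr0 addr0.
have -> : orthocomp M = \bigcap_(x in M) [set y | inner x y = 0] by [].
apply: closed_bigI => x _.
apply: (@closed_zeros _ _ `|x|) => // y z.
by rewrite -innerBr; exact: cauchy_schwarz.
Qed.

Lemma orthocompP M x : orthocomp M x -> M x -> x = 0.
Proof. by move=> h Mx; apply: inner_eq0; exact: h. Qed.

(** If [f] is nonzero, take [w] orthogonal to its kernel with [f w] nonzero. Each
    [x - (f x / f w) *: w] is in the kernel, so [f x] is a fixed multiple of [inner x w]. *)
Lemma riesz (f : V -> R[i]) (C : R[i]) : 0 <= C ->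
  (forall a x y, f (a *: x + y) = a * f x + f y) ->
  (forall x, `|f x| <= C * `|x|) -> exists z, forall x, f x = inner x z.
Proof.
move=> C0 flin fC.
have f0 : f 0 = 0.
  by have := fC 0; rewrite normr0 mulr0 normr_le0 => /eqP.
have fZ a x : f (a *: x) = a * f x by rewrite -[_ *: _]addr0 flin f0 addr0.
have fB x y : f (x - y) = f x - f y.
  by rewrite [x - y]addrC -[- y]scaleN1r flin mulN1r addrC.
pose K := [set x | f x = 0].
have cK : closed_subspace K.
  split=> //; first by apply: (@closed_zeros _ f C) => // x y; rewrite -fB.
  by move=> a x y hx hy; rewrite /K /= flin hx hy mulr0 addr0.
have [fz|/existsNP[x0 fx0]] := pselect (forall x, f x = 0).
  by exists 0 => x; rewrite inner0r.
have [p Kp op] := orthogonal_projection x0 cK.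
set w := x0 - p in op.
have fw : f w != 0 by rewrite fB Kp subr0; exact/eqP.
have ww : inner w w != 0.
  by apply: contra fw => /eqP/inner_eq0->; rewrite f0.
exists (Num.conj (f w / inner w w) *: w) => x.
rewrite innerZr conjCK.
have : inner (x - (f x / f w) *: w) w = 0.
  by apply: op; rewrite /K /= fB fZ divfK // subrr.
rewrite innerBl innerZl => /eqP; rewrite subr_eq0 => /eqP->.
by field; rewrite fw ww.
Qed.

End Subspaces.

(** * A single contraction: adjoint, reducing subspaces and unitary part *)

Section Contraction.
Variables (R : realType) (V : hilbertType R) (T : {linear V -> V}).
Implicit Types (x y z : V) (M N : set V).

(** [opnorm_on] bounds real parts on the unit ball. Rescaling reaches every [x], and a norm, being
    nonnegative, equals its real part. *)
Lemma contraction_norm : contraction_op T -> forall x, `|T x| <= `|x|.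
Proof.
move=> [_ hT] x; have [->|x0] := eqVneq x 0; first by rewrite linear0.
have nx0 : 0 < `|x| by rewrite normr_gt0.
pose y := `|x|^-1 *: x.
have ny : `|y| = 1 by rewrite normrZ normfV normr_id mulVf ?gt_eqF.
have : ((complex.Re `|T y|)%:E <= 1)%E.
  apply: le_trans hT; apply: ereal_sup_ubound; exists y => //=; split => //.
  by rewrite ny.
rewrite lee_fin => h.
have : `|T y| <= 1.
  have : 0 <= `|T y| by [].
  move: h; case: (`|T y|) => a b /= h; rewrite !lecE /= => /andP[/eqP-> _].
  by rewrite eqxx.
by rewrite linearZ normrZ normfV normr_id mulrC ler_pdivrMr // mul1r.
Qed.

Hypothesis nT : forall x, `|T x| <= `|x|.

Lemma contraction_on_invariant N : Defs.invariant N T -> contraction_on N T.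
Proof.
move=> iN; split => //; apply: ge_ereal_sup => _ [x [Nx x1] <-].
rewrite lee_fin; have := le_trans (nT x) x1.
by rewrite lecE => /andP[].
Qed.

(** [riesz] supplies a vector with the defining property, so [xget] does not fall back on its
    default 0. *)
Lemma adjointE x y : inner (T x) y = inner x (adjoint T y).
Proof.
have [||z hz] := @riesz _ _ (fun x => inner (T x) y) `|y| (normr_ge0 _).
- by move=> a u v; rewrite linearP innerDl innerZl.
- move=> u; rewrite mulrC; apply: le_trans (cauchy_schwarz _ _) _.
  by rewrite ler_wpM2r.
have [_ h] := @xgetI _ 0 [set z | (setT : set V) z /\
  forall x, setT x -> inner (T x) y = inner x z] z (conj I (fun x _ => hz x)).
exact: h.
Qed.

Lemma adjointC x y : inner (adjoint T x) y = inner x (T y).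
Proof. by rewrite inner_conj -adjointE -inner_conj. Qed.

Lemma adjointP a x y : adjoint T (a *: x + y) = a *: adjoint T x + adjoint T y.
Proof.
by apply: inner_injr => z; rewrite -adjointE !innerDr !innerZr -!adjointE.
Qed.

Lemma adjoint_norm x : `|adjoint T x| <= `|x|.
Proof.
have [->|h] := eqVneq (adjoint T x) 0; first by rewrite normr0.
rewrite -(@ler_pM2l _ `|adjoint T x|) ?normr_gt0 // -expr2 normr_inner.
rewrite -adjointE -[X in X <= _]ger0_norm; last first.
  by rewrite adjointE -normr_inner exprn_ge0.
by apply: le_trans (cauchy_schwarz _ _) _; rewrite ler_wpM2r.
Qed.

(** Both vectors lie in [N] and represent the same functional on [N], so their difference is
    orthogonal to itself. This trades adjoints of restrictions for the global adjoint. *)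
Lemma adjoint_onE N y : closed_subspace N -> N (adjoint T y) ->
  adjoint_on N T y = adjoint T y.
Proof.
move=> cN Ny.
have [Nz hz] := @xgetI _ 0 [set z | N z /\
  forall x, N x -> inner (T x) y = inner x z] (adjoint T y)
  (conj Ny (fun x _ => adjointE x y)).
rewrite -/(adjoint_on N T y) in Nz hz.
apply/eqP; rewrite -subr_eq0; apply/eqP/inner_eq0; rewrite innerBr -hz.
  by rewrite adjointE subrr.
exact: closed_subspaceB.
Qed.

Lemma reducesP N : reduces T N <->
  [/\ closed_subspace N, forall x, N x -> N (T x) &
      forall x, N x -> N (adjoint T x)].
Proof. by split=> [[]|[]]. Qed.

Lemma reduces_orthocomp N : reduces T N -> reduces T (orthocomp N).
Proof.
move=> /reducesP[cN NT NA]; apply/reducesP; split.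
- exact: orthocomp_closed_subspace.
- by move=> x hx y Ny; rewrite -adjointC hx //; exact: NA.
- by move=> x hx y Ny; rewrite -adjointE hx //; exact: NT.
Qed.

Lemma reducesI M N : reduces T M -> reduces T N -> reduces T (M `&` N).
Proof.
move=> /reducesP[cM MT MA] /reducesP[cN NT NA]; apply/reducesP; split.
- exact: closed_subspaceI.
- by move=> x [? ?]; split; [exact: MT|exact: NT].
- by move=> x [? ?]; split; [exact: MA|exact: NA].
Qed.

Lemma unitary_onP N : reduces T N -> unitary_on N T <->
  forall x, N x -> adjoint T (T x) = x /\ T (adjoint T x) = x.
Proof.
move=> /reducesP[cN NT NA]; split=> [[_ h] x Nx|h].
  by have := h x Nx; rewrite !adjoint_onE //; [exact: NA|apply: NA; exact: NT].
split=> // x Nx; rewrite !adjoint_onE //; [exact: h|exact: NA|].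
by apply: NA; exact: NT.
Qed.

(** The letter [true] is the adjoint and [false] is [T]; the head of the list acts last. *)
Definition word (s : seq bool) x : V :=
  foldr (fun b y => if b then adjoint T y else T y) x s.

Lemma word_linear s a x y : word s (a *: x + y) = a *: word s x + word s y.
Proof. by elim: s => //= -[] s ->; rewrite ?adjointP ?linearP. Qed.

Lemma word_norm s x : `|word s x| <= `|x|.
Proof.
elim: s => //= -[] s IH; first exact: le_trans (adjoint_norm _) IH.
exact: le_trans (nT _) IH.
Qed.

Lemma word0 s : word s 0 = 0.
Proof. by apply/eqP; rewrite -normr_le0 -[leRHS](normr0 V) word_norm. Qed.

Lemma word_reduces N s x : reduces T N -> N x -> N (word s x).
Proof.
move=> /reducesP[_ NT NA] Nx; elim: s => //= -[] s IH; [exact: NA|exact: NT].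
Qed.

Lemma word_commute (S : V -> V) s x :
  (forall y, S (T y) = T (S y)) ->
  (forall y, S (adjoint T y) = adjoint T (S y)) ->
  S (word s x) = word s (S x).
Proof. by move=> ST SA; elim: s => //= -[] s IH; rewrite ?ST ?SA IH. Qed.

Definition unitary_part : set V := [set x | forall s,
  adjoint T (T (word s x)) = word s x /\ T (adjoint T (word s x)) = word s x].

(** Words are linear and do not increase norms, so the difference of two words is Lipschitz with
    constant 2. The unitary part is an intersection of such sets. *)
Lemma fixed_word_closed_subspace s t :
  closed_subspace [set x | word s x = word t x].
Proof.
split; last 2 first.
- by rewrite /= !word0.
- by move=> a x y /= hx hy; rewrite !word_linear hx hy.
have -> : [set x | word s x = word t x] = [set x | word s x - word t x = 0].
  apply/seteqP; split=> x /=; first by move->; rewrite subrr.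
  by move=> /eqP; rewrite subr_eq0 => /eqP.
apply: (@closed_zeros _ _ V _ 2) => // x y.
have wB r : word r (x - y) = word r x - word r y.
  by rewrite [x - y]addrC -[- y]scaleN1r word_linear scaleN1r addrC.
rewrite opprD addrACA -opprD -!wB; apply: le_trans (ler_normB _ _) _.
by rewrite mulr_natl mulr2n lerD // word_norm.
Qed.

Lemma unitary_part_closed_subspace : closed_subspace unitary_part.
Proof.
have -> : unitary_part = \bigcap_s
    ([set x | word (true :: false :: s) x = word s x] `&`
     [set x | word (false :: true :: s) x = word s x]).
  by apply/seteqP; split=> x h s; [move=> _; exact: h|exact: (h s I)].
apply: closed_subspace_bigcap => s.
by apply: closed_subspaceI; exact: fixed_word_closed_subspace.
Qed.

Lemma unitary_part_word s x : unitary_part x -> unitary_part (word s x).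
Proof. by move=> Ux t; rewrite /word -foldr_cat; exact: Ux. Qed.

Lemma unitary_part_reduces : reduces T unitary_part.
Proof.
apply/reducesP; split; first exact: unitary_part_closed_subspace.
- by move=> x; exact: (unitary_part_word [:: false]).
- by move=> x; exact: (unitary_part_word [:: true]).
Qed.

Lemma unitary_on_sub N :
  reduces T N -> N `<=` unitary_part -> unitary_on N T.
Proof. by move=> rN sN; apply/unitary_onP => // x /sN /(_ [::]). Qed.

Lemma unitary_part_max N :
  reduces T N -> unitary_on N T -> N `<=` unitary_part.
Proof.
by move=> rN /(unitary_onP rN) uN x Nx s; apply: uN; exact: word_reduces.
Qed.

Lemma unitary_part_commute (S : V -> V) :
  (forall y, S (T y) = T (S y)) ->
  (forall y, S (adjoint T y) = adjoint T (S y)) ->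
  forall x, unitary_part x -> unitary_part (S x).
Proof.
move=> ST SA x Ux s; rewrite -(word_commute _ _ ST SA) -ST -SA -SA -ST.
by have [-> ->] := Ux s.
Qed.

(** A subspace [L] that reduces the restriction to a unitary also reduces [T], because the two
    adjoints agree on [N]. So [L] lies both in the unitary part and in its complement, hence is
    zero. *)
Lemma cnu_on_sub N :
  reduces T N -> N `<=` orthocomp unitary_part -> cnu_on N T.
Proof.
move=> /reducesP[cN NT NA] sN; split; first exact: contraction_on_invariant.
move=> [L [L0 [cL LN LT LA] uL]]; apply: L0.
have rL : reduces T L.
  apply/reducesP; split => // x Lx.
  rewrite -(@adjoint_onE N) //; first exact: LA.
  exact/NA/LN.
apply/seteqP; split=> [x Lx|_ ->]; last by case: cL.
by apply: (orthocompP (sN _ (LN _ Lx))); exact: unitary_part_max Lx.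
Qed.

(* Each defect [T^* T w p - w p] lies in [N], each [T^* T w q - w q] in its
   complement; their sum vanishes, hence both do. *)
Lemma unitary_part_split N p q : reduces T N -> N p -> orthocomp N q ->
  unitary_part (p + q) -> unitary_part p /\ unitary_part q.
Proof.
move=> rN Np Nq U; have rN' := reduces_orthocomp rN.
have cN : closed_subspace N by case: rN.
have cN' : closed_subspace (orthocomp N) by case: rN'.
have key s t : word s (p + q) = word t (p + q) ->
    word s p = word t p /\ word s q = word t q.
  have wD r : word r (p + q) = word r p + word r q.
    by rewrite -[p]scale1r word_linear !scale1r.
  rewrite !wD => h.
  have e : word s q - word t q = word t p - word s p.
    by apply/eqP; rewrite subr_eq addrAC eq_sym subr_eq -h addrC.
  have e0 : word s q - word t q = 0.
    apply: (@orthocompP _ _ N).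
      apply: (closed_subspaceB cN'); first exact: (word_reduces s rN' Nq).
      exact: (word_reduces t rN' Nq).
    rewrite e; apply: (closed_subspaceB cN); first exact: word_reduces.
    exact: word_reduces.
  split; first by apply/eqP; rewrite eq_sym -subr_eq0 -e e0.
  by apply/eqP; rewrite -subr_eq0 e0.
by split=> s; have [/(key [:: true, false & s]) [? ?]
  /(key [:: false, true & s]) [? ?]] := U s.
Qed.

(** For [u] in the unitary part, its component [u1] along [N] is there too by [unitary_part_split].
    Then [inner u p = inner u1 p = inner u1 (p + q) = 0]. *)
Lemma orthocomp_unitary_part_split N p q : reduces T N -> N p ->
  orthocomp N q -> orthocomp unitary_part (p + q) ->
  orthocomp unitary_part p /\ orthocomp unitary_part q.
Proof.
move=> rN Np Nq U; have cN : closed_subspace N by case: rN.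
suff h u : unitary_part u -> inner u p = 0.
  split=> u Uu; first exact: h.
  by have := U u Uu; rewrite innerDr h // add0r.
move=> Uu; have [u1 Nu1 Nu2] := orthogonal_projection u cN.
have [|U1 _] := unitary_part_split rN Nu1 Nu2; first by rewrite addrC subrK.
have := U u1 U1; rewrite innerDr Nq // addr0 => h1.
by rewrite -[u](subrK u1) innerDl h1 addr0 inner_sym0 //; exact: Nu2.
Qed.

(** For [u] in the unitary part, its component along [N] lies in the intersection of [N] with that
    part, on which [T] is unitary; complete non-unitarity makes it vanish. *)
Lemma cnu_on_orthocomp N :
  reduces T N -> cnu_on N T -> N `<=` orthocomp unitary_part.
Proof.
move=> rN [_ cnu] x Nx u Uu; have cN : closed_subspace N by case: rN.
have [p Np Nq] := orthogonal_projection u cN.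
have [|Up _] := unitary_part_split rN Np Nq; first by rewrite addrC subrK.
suff -> : u = u - p by apply: inner_sym0; exact: Nq.
suff -> : p = 0 by rewrite subr0.
apply: contrapT => p0; apply: cnu; exists (N `&` unitary_part).
have rI := reducesI rN unitary_part_reduces.
split; last by apply: unitary_on_sub => // y [].
- move=> e; apply: p0; have : (N `&` unitary_part) p by [].
  by rewrite e.
- have /reducesP[cI IT IA] := rI; split; [exact: cI|by move=> y []|exact: IT|].
  move=> y Iy; have Ay := IA _ Iy; rewrite (@adjoint_onE N) //.
  by case: Ay.
Qed.

End Contraction.

(** * Splitting a vector along finitely many complementary pairs at once *)

Section Splitting.
Variables (I : finType) (V : zmodType) (W : I -> bool -> V -> Prop).
Variable P : I -> bool -> V -> V.
Hypothesis WD : forall i b x y, W i b x -> W i b y -> W i b (x + y).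
Hypothesis P_sum : forall i b x, P i b x + P i (~~ b) x = x.
Hypothesis P_in : forall i b x, W i b (P i b x).
Hypothesis P_stable : forall i b j c x, W j c x -> W j c (P i b x).

Definition flip i (g : {ffun I -> bool}) := [ffun k => (k == i) (+) g k].

Lemma flipK i : involutive (flip i).
Proof. by move=> g; apply/ffunP => k; rewrite !ffunE addKb. Qed.

(** Induction on the indices treated. A new [i] cuts each term in two and sends the pieces to the
    two functions that differ at [i] only; [P_stable] preserves the memberships already obtained. *)
Lemma simultaneous_splitting (s : seq I) x :
  exists y : {ffun I -> bool} -> V,
    x = \sum_g y g /\
    forall (g : {ffun I -> bool}) i, i \in s -> W i (g i) (y g).
Proof.
elim: s => [|i s [y [xE hy]]].
  (* With no index treated, all of [x] may sit at one arbitrary function. *)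
  pose g0 : {ffun I -> bool} := [ffun => false].
  exists (fun g : {ffun I -> bool} => if g == g0 then x else 0); split => //.
  by rewrite -big_mkcond big_pred1_eq.
have [si|si] := boolP (i \in s).
  by exists y; split => // g k; rewrite inE => /predU1P[->|]; exact: hy.
exists (fun g : {ffun I -> bool} =>
  P i (g i) (y g) + P i (g i) (y (flip i g))); split.
  (* Reindexing the second sum by [flip i] brings together the two pieces of the same [y g]. *)
  rewrite big_split /= [X in _ + X](reindex_inj (inv_inj (flipK i))) -big_split.
  rewrite xE; apply: eq_bigr => g _ /=.
  by rewrite flipK !ffunE eqxx P_sum.
move=> g k; rewrite inE => /predU1P[->|ks]; apply: WD => //; apply: P_stable.
  exact: hy.
(* Here [k] differs from [i], which is not in [s], so the flip leaves the value at [k] unchanged. *)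
have := hy (flip i g) k ks; rewrite ffunE.
by have [ki|//] := eqVneq k i; rewrite ki (negPf si) in ks.
Qed.

End Splitting.

(** * Binary digits of the indices *)

Section Bits.

Lemma eq_bits n j k : (j < 2 ^ n)%N -> (k < 2 ^ n)%N ->
  (forall i, (i < n)%N -> odd (j %/ 2 ^ i) = odd (k %/ 2 ^ i)) -> j = k.
Proof.
elim: n j k => [|n IH] j k; first by rewrite expn0; case: j k => [|?] [|?].
move=> jn kn h.
have odd_jk : odd j = odd k by have := h 0%N isT; rewrite !divn1.
have half_lt m : (m < 2 ^ n.+1)%N -> (m./2 < 2 ^ n)%N.
  by move=> mn; rewrite -divn2 ltn_divLR // mulnC -expnS.
rewrite -(odd_double_half j) -(odd_double_half k) odd_jk; congr (_ + _.*2)%N.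
apply: IH => [||i ni]; try exact: half_lt.
by rewrite -!divn2 -!divnMA -expnS; exact: h.
Qed.

(** Digit [false] will select the unitary part and [true] its complement, so that the first index is
    the all-unitary one and the last the all-c.n.u. one. *)
Definition bits n (j : 'I_(2 ^ n)) : {ffun 'I_n -> bool} :=
  [ffun i : 'I_n => odd (j %/ 2 ^ i)].

Lemma bits_bij n : bijective (@bits n).
Proof.
apply: inj_card_bij; last by rewrite card_ffun card_bool !card_ord.
move=> j k /ffunP e; apply/val_inj.
apply: (eq_bits (ltn_ord j) (ltn_ord k)) => i ni.
by have := e (Ordinal ni); rewrite !ffunE.
Qed.

Lemma bits_first n i : bits (first_index n) i = false.
Proof. by rewrite ffunE div0n. Qed.

Lemma bits_last n i : bits (last_index n) i = true.
Proof.
(* The quotient is [(2 ^ m.+1).-1], odd because the exponent is positive; [m] will count the digits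
   above position [k]. *)
have key m k : odd ((2 ^ (m.+1 + k)).-1 %/ 2 ^ k).
  have -> : ((2 ^ (m.+1 + k)).-1 = (2 ^ m.+1).-1 * 2 ^ k + (2 ^ k).-1)%N.
    have k0 := pow2_gt0 k; have m0 := pow2_gt0 m.+1.
    by rewrite expnD -!subn1 mulnBl mul1n addnBA // subnK // leq_pmull.
  rewrite divnMDl ?pow2_gt0 // divn_small ?pow2_pred_lt // addn0.
  by rewrite -subn1 oddB ?pow2_gt0 // oddX.
by have := key (n - i.+1)%N i; rewrite addSnnS subnK // ffunE.
Qed.

End Bits.

(** * Joint parts of a doubly commuting tuple *)

Section DoublyCommuting.
Variables (R : realType) (V : hilbertType R) (n : nat).
Variable T : 'I_n -> {linear V -> V}.
Hypothesis hT : forall i, contraction_op (T i).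
Hypothesis hdc : doubly_commuting T.

Let nT i := contraction_norm (hT i).

(** For distinct indices, [T j] and its adjoint commute with [T i] and its adjoint: the mixed
    relations are double commutativity in both orders, and the one between adjoints is dual to
    [TT]. *)
Lemma reduces_unitary_part i j : reduces (T j) (unitary_part (T i)).
Proof.
have [->|ij] := eqVneq i j; first exact: unitary_part_reduces.
have [TT TA] := hdc.
apply/reducesP; split; first exact: unitary_part_closed_subspace.
  apply: (unitary_part_commute (S := T j)) => y; first exact: TT.
  by apply: TA; rewrite eq_sym.
apply: (unitary_part_commute (S := adjoint (T j))) => y; first by rewrite TA.
by apply: inner_injr => x; rewrite -!(adjointE (nT _)) TT.
Qed.

Definition part i (b : bool) : set V :=
  if b then orthocomp (unitary_part (T i)) else unitary_part (T i).

Lemma reduces_part i j b : reduces (T j) (part i b).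
Proof.
by case: b; [apply: reduces_orthocomp => //|]; exact: reduces_unitary_part.
Qed.

Lemma part_split i b N p q : reduces (T i) N -> N p -> orthocomp N q ->
  part i b (p + q) -> part i b p /\ part i b q.
Proof.
by case: b; [exact: orthocomp_unitary_part_split|exact: unitary_part_split].
Qed.

Definition joint_part (g : 'I_n -> bool) : set V := \bigcap_i part i (g i).

Lemma joint_part_reducing g : joint_reducing T (joint_part g).
Proof.
have cg : closed_subspace (joint_part g).
  by apply: closed_subspace_bigcap => i; case: (reduces_part i i (g i)).
split => // j; apply/reducesP; split => // x hx i _;
  have /reducesP[_ pT pA] := reduces_part i j (g i);
  [apply: pT|apply: pA]; exact: hx.
Qed.

Lemma joint_part_unitary g i : g i = false -> unitary_on (joint_part g) (T i).
Proof.
move=> gi; apply: unitary_on_sub => //; first by case: (joint_part_reducing g).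
by move=> x /(_ i I); rewrite gi.
Qed.

Lemma joint_part_cnu g i : g i = true -> cnu_on (joint_part g) (T i).
Proof.
move=> gi; apply: cnu_on_sub => //; first by case: (joint_part_reducing g).
by move=> x /(_ i I); rewrite gi.
Qed.

Lemma joint_part_orthogonal g h x y :
  ~ g =1 h -> joint_part g x -> joint_part h y -> inner x y = 0.
Proof.
move=> /existsNP[i /eqP]; move=> gh /(_ i I) + /(_ i I).
case: (g i) (h i) gh => [] [] //= _ hx hy; last exact: hy.
by apply: inner_sym0; exact: hx.
Qed.

Lemma joint_part_total x : exists y : {ffun 'I_n -> bool} -> V,
  x = \sum_g y g /\ forall g : {ffun _ -> bool}, joint_part g (y g).
Proof.
have /choice[p hp] : forall iv : 'I_n * V, exists p,
    unitary_part (T iv.1) p /\ orthocomp (unitary_part (T iv.1)) (iv.2 - p).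
  move=> [i v].
  have [p] := orthogonal_projection v (unitary_part_closed_subspace (nT i)).
  by exists p.
pose P i b v := if b : bool then v - p (i, v) else p (i, v).
have [||||y [xE hy]] :=
    @simultaneous_splitting _ _ part P _ _ _ _ (enum 'I_n) x.
- by move=> i b u v; apply: closed_subspaceD; case: (reduces_part i i b).
- by move=> i [] v /=; rewrite ?subrK // addrC subrK.
- by move=> i [] v; case: (hp (i, v)).
(* Stability: the unitary part of [T i] reduces [T j], so [part_split] keeps both components of [v]
   in [part j c]. *)
- move=> i b j c v hv; have [/= h1 h2] := hp (i, v).
  have [|] := part_split (b := c) (reduces_unitary_part i j) h1 h2.
    by rewrite addrC subrK.
  by case: b.
exists y; split => // g i _; apply: hy; exact: mem_enum.
Qed.

End DoublyCommuting.

Theorem theorem4p4 (R : realType) (V : hilbertType R) (n : nat)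
    (T : 'I_n -> {linear V -> V})
    (hT : forall i, contraction_op (T i)) (hdc : doubly_commuting T) :
  exists (H : 'I_(2 ^ n) -> set V) (types : 'I_(2 ^ n) -> 'I_n -> atom_type),
    orthogonal_decomposition H /\
    (* (1) *)
    (forall j, joint_reducing T (H j)) /\
    (* (2) *)
    (forall i j, unitary_on (H j) (T i) \/ cnu_on (H j) (T i)) /\
    (* (3) *)
    ((forall j k, atom_on (H j) (T k) (types j k)) /\
     (forall g : 'I_n -> atom_type,
        exists! j : 'I_(2 ^ n), forall k, types j k = g k)) /\
    (* (4) *)
    (joint_reducing T (H (first_index n)) /\
     (forall i, unitary_on (H (first_index n)) (T i)) /\
     (forall L : set V, joint_reducing T L ->
        (forall i, unitary_on L (T i)) -> L `<=` H (first_index n))) /\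
    (* (5) *)
    (joint_reducing T (H (last_index n)) /\
     (forall i, cnu_on (H (last_index n)) (T i)) /\
     (forall L : set V, joint_reducing T L ->
        (forall i, cnu_on L (T i)) -> L `<=` H (last_index n))).
Proof.
have nT i := contraction_norm (hT i).
pose H (j : 'I_(2 ^ n)) := joint_part T (bits j).
(* Types are read off the digits, not off the restrictions: operators on a zero summand have both
   types, so only an assigned list can single out an index. *)
pose types (j : 'I_(2 ^ n)) i := if bits j i then A2 else A1.
have rH j : joint_reducing T (H j) by exact: joint_part_reducing.
have tH j k : atom_on (H j) (T k) (types j k).
  rewrite /types; case E: (bits j k); first exact: joint_part_cnu.
  exact: joint_part_unitary.
exists H, types; split; last split => //; last split; last split; last split.
- split; first by move=> j; case: (rH j).
    move=> j k jk x y; apply: joint_part_orthogonal => /ffunP.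
    by move=> /(bij_inj (@bits_bij n)) e; rewrite e eqxx in jk.
  move=> x; have [y [xE hy]] := joint_part_total hT hdc x.
  exists (y \o @bits n); split; first by move=> j; exact: hy.
  by rewrite xE (reindex (@bits n)) //; apply: onW_bij; exact: bits_bij.
- by move=> i j; have := tH j i; case: (types j i); [left|right].
- split => // g; have [c cK Kc] := @bits_bij n.
  pose f : {ffun 'I_n -> bool} := [ffun i => if g i is A2 then true else false].
  exists (c f); split => [k|j hj].
    by rewrite /types Kc ffunE; case: (g k).
  rewrite -(cK j); congr c; apply/ffunP => k.
  by rewrite ffunE -hj /types; case: (bits j k).
- split; first exact: rH.
  split; first by move=> i; apply: joint_part_unitary => //; exact: bits_first.
  move=> L [_ rL] uL x Lx i _; rewrite bits_first.
  exact: (unitary_part_max (nT i) (rL i) (uL i)).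
- split; first exact: rH.
  split; first by move=> i; apply: joint_part_cnu => //; exact: bits_last.
  move=> L [_ rL] uL x Lx i _; rewrite bits_last.
  exact: (cnu_on_orthocomp (nT i) (rL i) (uL i)).
Qed.
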